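(* Let $\mathcal{H}=(X;\tau_0,\tau_1,\tau_2)$ be a hypermap and let $A\subseteq\mathcal{E}(\mathcal{H})$. The state circles of the state $S_A$ are naturally in bijection with the vertices of the partial dual $\mathcal{H}^A$ (a state circle corresponds to the vertex of $\mathcal{H}^A$ having the same set of flags). If $C$ is a state circle and $v_C$ is the corresponding vertex of $\mathcal{H}^A$, then $$\operatorname{val}_{\mathcal{H}^A}(v_C)=\ell(C).$$
   Context: A hypermap is a triple $\mathcal{H}=(X;\tau_0,\tau_1,\tau_2)$ where $X$ is a finite set (of flags), each $\tau_i$ is a fixed-point-free involution on $X$, and $\langle\tau_0,\tau_1,\tau_2\rangle$ acts transitively on $X$. Vertices and hyperedges are the orbits $\mathcal{V}(\mathcal{H})=X/\langle\tau_1,\tau_2\rangle$ and $\mathcal{E}(\mathcal{H})=X/\langle\tau_0,\tau_2\rangle$. The valence $\operatorname{val}(v)$ of a vertex $v$ is $|v|/2$. Partial dual: for $A\subseteq\mathcal{E}(\mathcal{H})$ let $X_A=\bigcup_{e\in A}e$. Then $\mathcal{H}^A=(X;\tau_0^A,\tau_1,\tau_2^A)$, where for $x\in X_A$: $\tau_0^A(x)=\tau_2(x)$, $\tau_2^A(x)=\tau_0(x)$; and for $x\notin X_A$: $\tau_0^A(x)=\tau_0(x)$, $\tau_2^A(x)=\tau_2(x)$. State: define the involution $\eta_A$ on $X$ by $\eta_A(x)=\tau_0(x)$ if $x\in X_A$ and $\eta_A(x)=\tau_2(x)$ if $x\notin X_A$. The state $S_A$ is the edge-coloured multigraph with vertex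 set $X$ whose two edge classes are the transpositions $\{x,\tau_1x\}$ of $\tau_1$ and the transpositions $\{x,\eta_Ax\}$ of $\eta_A$ (if a $\tau_1$-transposition and an $\eta_A$-transposition have the same endpoints, they are two parallel edges of different colours). The connected components of $S_A$ are called state circles. For a state circle $C$, $\ell(C)$ is the number of $\tau_1$-edges in $C$. *)

(* Defs.v *)
From HB Require Import structures.
From mathcomp Require Import all_boot all_fingroup.

Set Implicit Arguments.
Unset Strict Implicit.
Unset Printing Implicit Defensive.

Local Open Scope group_scope.

(* Transitivity is spelled out rather than taken from [transitive G, on S | to],
   because the latter also forces S to be nonempty. *)
Record hypermap (X : finType) := Hypermap {
  tau0 : {perm X};
  tau1 : {perm X};
  tau2 : {perm X};
  tau0K : involutive tau0;
  tau1K : involutive tau1;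
  tau2K : involutive tau2;
  tau0_fpf : forall x, tau0 x != x;
  tau1_fpf : forall x, tau1 x != x;
  tau2_fpf : forall x, tau2 x != x;
  hypermap_trans :
    forall x y, y \in orbit 'P <<[set tau0; tau1; tau2]>> x
}.

Section HypermapTheory.

Variables (X : finType) (H : hypermap X).
Implicit Types (A : {set {set X}}) (v : {set X}).

Definition vertices : {set {set X}} :=
  [set orbit 'P <<[set tau1 H; tau2 H]>> x | x in [set: X]].

Definition hyperedges : {set {set X}} :=
  [set orbit 'P <<[set tau0 H; tau2 H]>> x | x in [set: X]].

(* The division is exact on vertices: see valenceE. *)
Definition valence v : nat := #|v| %/ 2.

Lemma orbit_gen_act (B : {set {perm X}}) (s : {perm X}) (x y : X) :
  s \in B -> (s x \in orbit 'P <<B>> y) = (x \in orbit 'P <<B>> y).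
Proof.
move=> sB; have sG : s \in <<B>> by apply: mem_gen.
have E : orbit 'P <<B>> (s x) = orbit 'P <<B>> x by exact: orbit_act.
by rewrite orbit_sym -[RHS]orbit_sym E.
Qed.

Lemma valenceE v : v \in vertices -> (valence v * 2)%N = #|v|.
Proof.
case/imsetP=> x _ ->; rewrite /valence divnK //.
set O := orbit _ _ _.
have tO y : (tau1 H y \in O) = (y \in O).
  by rewrite /O orbit_gen_act // !inE eqxx.
have K := tau1K H.
pose P := [set [set y; tau1 H y] | y in O].
have e_tau y z : z \in [set y; tau1 H y] -> [set y; tau1 H y] = [set z; tau1 H z].
  by rewrite !inE => /orP[] /eqP -> //; rewrite K setUC.
have covP : cover P = O.
  apply/setP=> z; apply/bigcupP/idP => [[_ /imsetP[y yO ->]]|zO].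
    by rewrite !inE => /orP[] /eqP ->; rewrite ?tO.
  by exists [set z; tau1 H z]; [exact: (imset_f (fun y => [set y; tau1 H y])) | rewrite !inE eqxx].
have tivP : trivIset P.
  apply/trivIsetP=> _ _ /imsetP[y _ ->] /imsetP[z _ ->].
  apply: contraR => /pred0Pn[w /andP[/= wy wz]].
  by rewrite (e_tau _ _ wy) (e_tau _ _ wz).
rewrite -covP -(eqP tivP) (eq_bigr (fun=> 2)) ?sum_nat_const ?dvdn_mull //.
by move=> _ /imsetP[y _ ->]; rewrite cards2 eq_sym tau1_fpf.
Qed.

(* For a set A of hyperedges, X_A is the library's [cover A]. *)
Definition dual_tau0 A (x : X) : X := if x \in cover A then tau2 H x else tau0 H x.
Definition dual_tau2 A (x : X) : X := if x \in cover A then tau0 H x else tau2 H x.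

Section PartialDual.

Variables (A : {set {set X}}) (hA : A \subset hyperedges).

Lemma cover_tau (s : {perm X}) (x : X) :
  s \in [set tau0 H; tau2 H] -> (s x \in cover A) = (x \in cover A).
Proof.
move=> sB; apply/bigcupP/bigcupP=> -[e eA xe]; exists e => //;
  case/imsetP: (subsetP hA e eA) xe => y _ -> ; by rewrite orbit_gen_act.
Qed.

Lemma cover_tau0 (x : X) : (tau0 H x \in cover A) = (x \in cover A).
Proof. by apply: cover_tau; rewrite !inE eqxx. Qed.

Lemma cover_tau2 (x : X) : (tau2 H x \in cover A) = (x \in cover A).
Proof. by apply: cover_tau; rewrite !inE eqxx orbT. Qed.

Lemma dual_tau0K : involutive (dual_tau0 A).
Proof.
move=> x; rewrite /dual_tau0; case xA: (x \in cover A).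
  by rewrite cover_tau2 xA tau2K.
by rewrite cover_tau0 xA tau0K.
Qed.

Lemma dual_tau2K : involutive (dual_tau2 A).
Proof.
move=> x; rewrite /dual_tau2; case xA: (x \in cover A).
  by rewrite cover_tau0 xA tau0K.
by rewrite cover_tau2 xA tau2K.
Qed.

Definition pd_tau0 : {perm X} := perm (can_inj dual_tau0K).
Definition pd_tau2 : {perm X} := perm (can_inj dual_tau2K).

Fact pd_tau0K : involutive pd_tau0.
Proof. by move=> x; rewrite !permE dual_tau0K. Qed.

Fact pd_tau2K : involutive pd_tau2.
Proof. by move=> x; rewrite !permE dual_tau2K. Qed.

Fact pd_tau0_fpf x : pd_tau0 x != x.
Proof. by rewrite permE /dual_tau0; case: ifP; rewrite ?tau2_fpf ?tau0_fpf. Qed.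

Fact pd_tau2_fpf x : pd_tau2 x != x.
Proof. by rewrite permE /dual_tau2; case: ifP; rewrite ?tau2_fpf ?tau0_fpf. Qed.

Fact pd_trans x y : y \in orbit 'P <<[set pd_tau0; tau1 H; pd_tau2]>> x.
Proof.
set O := orbit _ _ _.
have t0 z : (pd_tau0 z \in O) = (z \in O).
  by rewrite /O orbit_gen_act // !inE eqxx.
have t1 z : (tau1 H z \in O) = (z \in O)
  by apply: orbit_gen_act; rewrite !inE eqxx orbT.
have t2 z : (pd_tau2 z \in O) = (z \in O)
  by apply: orbit_gen_act; rewrite !inE eqxx !orbT.
have stab : <<[set tau0 H; tau1 H; tau2 H]>> \subset 'N(O | 'P).
  rewrite gen_subG; apply/subsetP=> s sB; rewrite !inE /=; apply/subsetP=> z zO.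
  rewrite inE /= apermE; move: sB; rewrite !inE -orbA => /or3P[] /eqP ->.
  - move: (t0 z) (t2 z); rewrite !permE /dual_tau0 /dual_tau2.
    by case: ifP => _ e0 e2; rewrite ?e0 ?e2.
  - by rewrite t1.
  - move: (t0 z) (t2 z); rewrite !permE /dual_tau0 /dual_tau2.
    by case: ifP => _ e0 e2; rewrite ?e0 ?e2.
have /orbitP[g gG <-] := hypermap_trans H x y.
by rewrite (astabs_act x (subsetP stab g gG)) orbit_refl.
Qed.

Definition partial_dual : hypermap X :=
  Hypermap pd_tau0K (tau1K H) pd_tau2K
           pd_tau0_fpf (tau1_fpf H) pd_tau2_fpf pd_trans.

End PartialDual.

Definition eta A (x : X) : X := if x \in cover A then tau0 H x else tau2 H x.

End HypermapTheory.

(* A two-coloured multigraph is a set of vertices together with a set of edges;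
   an edge is a colour paired with its set of endpoints, so that edges of
   different colours with the same endpoints are distinct. *)
Definition mgraph (X : finType) : finType :=
  ({set X} * {set bool * {set X}})%type.

Section Multigraph.

Variables (X : finType) (G : mgraph X).

Definition mverts : {set X} := G.1.
Definition medges : {set bool * {set X}} := G.2.

Definition madj : rel X := [rel x y | [exists c, (c, [set x; y]) \in medges]].

Definition component_verts (x : X) : {set X} :=
  [set y in mverts | connect madj x y].

Definition component (x : X) : mgraph X :=
  (component_verts x, [set e in medges | e.2 \subset component_verts x]).

Definition components : {set mgraph X} := [set component x | x in mverts].

End Multigraph.

Definition transpositions (X : finType) (f : X -> X) : {set {set X}} :=
  [set [set x; f x] | x in [set: X]].

Definition tau1_colour : bool := false.
Definition eta_colour : bool := true.

Definition state (X : finType) (H : hypermap X) (A : {set {set X}}) : mgraph X :=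
  ([set: X], [set (tau1_colour, e) | e in transpositions (tau1 H)]
             :|: [set (eta_colour, e) | e in transpositions (eta H A)]).

Definition state_circles (X : finType) (H : hypermap X) (A : {set {set X}}) :
  {set mgraph X} := components (state H A).

Definition ell (X : finType) (C : mgraph X) : nat :=
  #|[set e in medges C | e.1 == tau1_colour]|.

(* Main.v *)
Require Import Defs.
From HB Require Import structures.
From mathcomp Require Import all_boot all_fingroup.

(** On the flags covered by [A], partial duality swaps [tau0 H] and [tau2 H];
    this turns [tau2 H] into the involution [Defs.eta H A]. Hence the vertices
    of the partial dual are the orbits of the group generated by [tau1 H] and
    [Defs.eta H A], while the state joins each flag exactly to its images under
    these same two involutions ([madj_state]). Since on a finite set the orbits
    of a generated group are the sets reachable by the generators
    ([connect_perms_orbit]), a state circle and its vertex have the same flags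
    ([state_component_verts]). A component is the subgraph induced on its
    vertices, so its flags determine it. Finally, the edges of a circle coloured
    by [tau1 H] pair off its flags, so their number is half the number of flags
    ([card_transpositions_in]), which is the valence. *)

Set Implicit Arguments.
Unset Strict Implicit.
Unset Printing Implicit Defensive.

Lemma connect_perms_orbit (X : finType) (B : {set {perm X}}) (e : rel X) :
    (forall x y, e x y = [exists s in B, y == s x]) ->
  forall x y, connect e x y = (y \in orbit 'P <<B>> x).
Proof.
move=> eE x y; apply/idP/idP => [cxy|].
  have clO : closed e [in orbit 'P <<B>> x].
    move=> z w; rewrite eE => /exists_inP[s sB /eqP ->].
    by rewrite -(orbit_gen_act z x sB).
  by have := closed_connect clO cxy; rewrite [LHS]orbit_refl => <-.
(* A permutation mapping the finite set of reachable points into itself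
   stabilises it, so reachability is preserved by inverses as well. *)
pose S := [set z | connect e x z].
have stab : (<<B>> \subset 'N(S | 'P))%g.
  rewrite gen_subG; apply/subsetP=> s sB; rewrite !inE /=.
  apply/subsetP=> z; rewrite !inE /= apermE => cxz.
  apply: connect_trans cxz _; apply: connect1; rewrite eE.
  by apply/exists_inP; exists s.
case/orbitP=> g gB <-.
have : 'P%act x g \in S by rewrite (astabs_act x (subsetP stab g gB)) inE.
by rewrite inE.
Qed.

Section FixedPointFreeInvolution.

Variables (X : finType) (f : X -> X).
Hypotheses (fK : involutive f) (f_fpf : forall x, f x != x).

Lemma transposition_of_mem x y :
  y \in [set x; f x] -> [set x; f x] = [set y; f y].
Proof. by rewrite !inE => /orP[] /eqP -> //; rewrite fK setUC. Qed.

(** Having no fixed point, [f] has no one-element transposition, so the case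
    [x = y] agrees with the equation on the right. *)
Lemma mem_transpositions x y :
  ([set x; y] \in transpositions f) = (y == f x).
Proof.
apply/imsetP/eqP => [[z _ xyE]|->]; last by exists x.
have xE : [set x; y] = [set x; f x].
  by rewrite xyE; apply: transposition_of_mem; rewrite -xyE set21.
have : f x \in [set x; y] by rewrite xE set22.
by rewrite !inE (negPf (f_fpf x)) => /eqP.
Qed.

(** The transpositions inside a stable set partition it into pairs: they are
    disjoint because [f] is involutive, and proper pairs because it fixes no
    point. *)
Lemma card_transpositions_in (O : {set X}) :
    (forall x, (f x \in O) = (x \in O)) ->
  #|O| = (#|[set t in transpositions f | t \subset O]| * 2)%N.
Proof.
move=> fO; set P := [set t in _ | _].
have PE t : t \in P -> exists2 x, x \in O & t = [set x; f x].
  rewrite inE => /andP[/imsetP[x _ ->] /subsetP sO].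
  by exists x => //; apply: sO; rewrite set21.
apply: card_uniform_partition => [t /PE[x _ ->]|].
  by rewrite cards2 eq_sym f_fpf.
apply/and3P; split.
- apply/eqP/setP=> x; apply/bigcupP/idP => [[t tP xt]|xO].
    by move: tP; rewrite inE => /andP[_ /subsetP]; apply.
  exists [set x; f x]; last by rewrite set21.
  by rewrite inE mem_transpositions eqxx subUset !sub1set fO xO.
- apply/trivIsetP=> _ _ /PE[x _ ->] /PE[y _ ->].
  apply: contraR => /pred0Pn[z /andP[/= zx zy]].
  by rewrite (transposition_of_mem zx) (transposition_of_mem zy).
- apply/negP=> /PE[x _ E]; have := set21 x (f x).
  by rewrite -E inE.
Qed.

End FixedPointFreeInvolution.

Lemma component_inj_mverts (X : finType) (G : mgraph X) :
  {in components G &, injective (@mverts X)}.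
Proof.
move=> _ _ /imsetP[x _ ->] /imsetP[y _ ->].
by rewrite /mverts /component /= => ->.
Qed.

Section State.

Variables (X : finType) (H : hypermap X) (A : {set {set X}}).

Lemma mem_state_tau1 (t : {set X}) :
  ((tau1_colour, t) \in medges (state H A)) = (t \in transpositions (tau1 H)).
Proof.
rewrite inE; apply/orP/idP => [[] /imsetP[u uT]|tT]; [by case=> -> | by [] |].
by left; apply: imset_f.
Qed.

Lemma mem_state_eta (t : {set X}) :
  ((eta_colour, t) \in medges (state H A)) = (t \in transpositions (Defs.eta H A)).
Proof.
rewrite inE; apply/orP/idP => [[] /imsetP[u uT]|tT]; [by [] | by case=> -> |].
by right; apply: imset_f.
Qed.

Lemma ell_component x :
  ell (component (state H A) x) =
  #|[set t in transpositions (tau1 H)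
       | t \subset component_verts (state H A) x]|.
Proof.
have pair_inj : injective (pair tau1_colour : {set X} -> _) by move=> s t [].
rewrite /ell -[RHS](card_imset _ pair_inj).
apply: eq_card => -[c t]; rewrite inE /= inE /=.
apply/andP/imsetP => [[/andP[ctE tO] /eqP cE]|[u + [-> ->]]].
  by exists t; rewrite ?cE // inE tO andbT -mem_state_tau1 -cE.
by rewrite inE -mem_state_tau1 => /andP[-> ->].
Qed.

Hypothesis hA : A \subset hyperedges H.

Lemma pd_tau2_eta x : pd_tau2 hA x = Defs.eta H A x.
Proof. by rewrite permE. Qed.

(** This depends on [A] consisting of hyperedges: only then is its cover stable
    under [tau0 H] and [tau2 H], so that both steps use the same involution. *)
Lemma eta_involutive : involutive (Defs.eta H A).
Proof. exact: dual_tau2K hA. Qed.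

Lemma eta_fpf x : Defs.eta H A x != x.
Proof. by rewrite -(pd_tau2_eta x) pd_tau2_fpf. Qed.

Lemma madj_state x y :
  madj (state H A) x y = [exists s in [set tau1 H; pd_tau2 hA], y == s x].
Proof.
have tauE := mem_transpositions (@tau1K _ H) (@tau1_fpf _ H) x y.
have etaE := mem_transpositions eta_involutive eta_fpf x y.
apply/existsP/exists_inP => [[[]]|[s]].
- rewrite mem_state_eta etaE -(pd_tau2_eta x) => yE.
  by exists (pd_tau2 hA); rewrite ?set22.
- by rewrite mem_state_tau1 tauE => yE; exists (tau1 H); rewrite ?set21.
- rewrite !inE => /orP[] /eqP -> yE.
    by exists tau1_colour; rewrite mem_state_tau1 tauE.
  by exists eta_colour; rewrite mem_state_eta etaE -(pd_tau2_eta x).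
Qed.

Lemma state_component_verts x :
  component_verts (state H A) x = orbit 'P <<[set tau1 H; pd_tau2 hA]>> x.
Proof.
apply/setP=> y; rewrite inE (connect_perms_orbit madj_state).
by rewrite /mverts inE.
Qed.

End State.

Theorem theorem3p7 (X : finType) (H : hypermap X) (A : {set {set X}})
    (hA : A \subset hyperedges H) :
  [/\ {in state_circles H A &, injective (@mverts X)},
      [set mverts C | C in state_circles H A] = vertices (partial_dual hA)
    & {in state_circles H A, forall C, valence (mverts C) = ell C}].
Proof.
split; first exact: component_inj_mverts.
- rewrite /state_circles /components -imset_comp.
  by apply: eq_in_imset => x _ /=; rewrite -state_component_verts.
move=> _ /imsetP[x _ ->]; rewrite ell_component /valence.
have tau1O y : (tau1 H y \in component_verts (state H A) x)
             = (y \in component_verts (state H A) x).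
  by rewrite (state_component_verts hA) orbit_gen_act ?set21.
rewrite /mverts /= (card_transpositions_in (@tau1K _ H) (@tau1_fpf _ H) tau1O).
by rewrite mulnK.
Qed.
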